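(* For every integer $n\ge0$, the even-indexed even-odd $q$-Lommel polynomials are given by $$p_{2n}(x;c,q)=(-1)^n\frac{q^{\binom n2}}{(c;q)_{2n}}\sum_{k=0}^n\frac{(q^{-n},cq^n,c;q)_k}{(q;q)_k}\,q^kx^{2k}\sum_{s=0}^{n-k}\frac{(cq^{k-1};q)_s}{(q;q)_s}\,\frac{1-cq^{k-1+2s}}{1-cq^{k-1}}\,\frac{(cq^{n+k},q^{k-n},q^k;q)_s}{(q^{-n},cq^n,c;q)_s}\,c^sq^{-sk+s(s-1)}.$$
   Context: $c,q$ are indeterminates. $(a;q)_n=\prod_{i=0}^{n-1}(1-aq^i)$ and $(a_1,\dots,a_r;q)_n=\prod_j(a_j;q)_n$. The even-odd $q$-Lommel polynomials are defined by $p_{-1}(x;c,q)=0$, $p_0(x;c,q)=1$, $p_{n+1}(x;c,q)=x\,p_n(x;c,q)-\lambda_np_{n-1}(x;c,q)$ for $n\ge0$, where $\lambda_{2n}=\dfrac{cq^{3n-1}}{(1-cq^{2n-1})(1-cq^{2n})}$ and $\lambda_{2n+1}=\dfrac{q^n}{(1-cq^{2n})(1-cq^{2n+1})}$. *)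

(* Defs.v *)
From HB Require Import structures.
From mathcomp Require Export all_boot all_order all_algebra.
From mathcomp Require Export mpoly.

Set Implicit Arguments.
Unset Strict Implicit.
Unset Printing Implicit Defensive.

Import GRing.Theory.
Local Open Scope ring_scope.

(* The field F(c, q) of rational functions in two indeterminates. *)
Definition ratfun2 (F : fieldType) : fieldType := {fraction {mpoly F[2]}}.

Definition indet_c (F : fieldType) : ratfun2 F := tofrac ('X_0 : {mpoly F[2]}).
Definition indet_q (F : fieldType) : ratfun2 F := tofrac ('X_1 : {mpoly F[2]}).

Section EvenOddLommel.

Variable K : fieldType.

Definition qpoch (a q : K) (n : nat) : K := \prod_(i < n) (1 - a * q ^+ i).

(* (a_1, ..., a_r; q)_n *)
Definition qpochs (s : seq K) (q : K) (n : nat) : K :=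
  \prod_(a <- s) qpoch a q n.

(* Exponents such as 3n - 1 are integers: at n = 0 they are negative. *)
Definition lommel_lambda (c q : K) (m : nat) : K :=
  let n := (m./2)%:Z in
  if odd m then
    q ^ n / ((1 - c * q ^ (2 * n)) * (1 - c * q ^ (2 * n + 1)))
  else
    c * q ^ (3 * n - 1) / ((1 - c * q ^ (2 * n - 1)) * (1 - c * q ^ (2 * n))).

(* The pair (p_{n-1}, p_n), starting from (p_{-1}, p_0) = (0, 1). *)
Fixpoint lommel_pair (c q : K) (n : nat) : {poly K} * {poly K} :=
  if n is m.+1 then
    let: (p_prev, p_cur) := lommel_pair c q m in
    (p_cur, 'X * p_cur - lommel_lambda c q m *: p_prev)
  else (0, 1).

Definition lommel (c q : K) (n : nat) : {poly K} := (lommel_pair c q n).2.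

End EvenOddLommel.

(* Main.v *)
Require Import Defs.
From mathcomp Require Import ring zify.

Set Implicit Arguments.
Unset Strict Implicit.
Unset Printing Implicit Defensive.

Import GRing.Theory.
Local Open Scope ring_scope.

(** The recurrence splits by parity: the even polynomials have coefficients
[even_coef n k] at x^(2k), the odd ones [odd_coef n k] at x^(2k+1), and the
recurrence of the polynomials amounts to two first-order relations between
these two arrays.

The terms of the double sum look as if they mixed n, k and s, but the factors
carrying n recombine, because
(q^-n)_k (q^(k-n))_s / (q^-n)_s = (q^(s-n))_k and likewise with cq^n in place
of q^-n.  Up to (-1)^n q^C(n,2) / (c)_(2n), the term is therefore
[even_weight k s * node n n s k], where [even_weight] is free of n and
node n n s k = (q^(s-n))_k (cq^(n+s))_k is the product of the factors
1 - q^i (q^-n + cq^n) + cq^(2i) for s <= i < s + k.  The odd coefficients have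
the same shape, with weight [weight k s * (1 - cq^(k+2s))] and (cq^(n+1+s))_k in
the node.

The relation giving the even coefficients from the odd ones then holds term by
term in s: the difference of the nodes for n and n+1 is a multiple of the odd
node ([node_diff_odd], [even_coefSS]).  The other relation does not hold term
by term, but the very-well-poised weight is itself a difference,
[even_weight k s] = w(s) - cq^(2s-2) w(s-1) with w = [weight k], so summation by
parts ([even_weight_parts]) moves the difference onto the nodes, where it
matches again ([node_diff_even], [odd_coefS]).  The boundary terms vanish,
except for k = 0 where those of both sides cancel.

All this is valid in any field where q and the 1 - q^(i+1), 1 - cq^i are
nonzero and c differs from q; two indeterminates satisfy these conditions. *)

(** * The q-Pochhammer symbol *)

Section QPochhammer.

Variable K : fieldType.
Implicit Types (a q : K) (n m : nat).

Lemma qpoch0 a q : qpoch a q 0 = 1.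
Proof. by rewrite /qpoch big_ord0. Qed.

Lemma qpochSr a q n : qpoch a q n.+1 = qpoch a q n * (1 - a * q ^+ n).
Proof. by rewrite /qpoch big_ord_recr. Qed.

Lemma qpochD a q m n : qpoch a q (m + n) = qpoch a q m * qpoch (a * q ^+ m) q n.
Proof.
elim: n => [|n IHn]; first by rewrite addn0 qpoch0 mulr1.
by rewrite addnS !qpochSr IHn exprD !mulrA.
Qed.

Lemma qpochSl a q n : qpoch a q n.+1 = (1 - a) * qpoch (a * q) q n.
Proof. by rewrite -add1n qpochD qpochSr qpoch0 expr1 expr0 mulr1 mul1r. Qed.

Lemma qpoch_exchange a q m n :
  qpoch a q m * qpoch (a * q ^+ m) q n = qpoch a q n * qpoch (a * q ^+ n) q m.
Proof. by rewrite -!qpochD addnC. Qed.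

Lemma qpoch_eq0 a q n i : (i < n)%N -> a * q ^+ i = 1 -> qpoch a q n = 0.
Proof.
move=> lt_in aq1.
by rewrite /qpoch (bigD1 (Ordinal lt_in)) //= aq1 subrr mul0r.
Qed.

Lemma qpoch_neq0 a q n :
  (forall i, (i < n)%N -> 1 - a * q ^+ i != 0) -> qpoch a q n != 0.
Proof. by move=> h; apply/prodf_neq0 => i _; apply: h. Qed.

End QPochhammer.

(** * The coefficients of the even and odd polynomials *)

Section EvenOddCoefficients.

Variables (K : fieldType) (c q : K).
Hypothesis q_neq0 : q != 0.
Hypothesis q_gen : forall i, 1 - q ^+ i.+1 != 0.
Hypothesis c_gen : forall i, 1 - c * q ^+ i != 0.

(** Up to powers of q this is (c)_k / (q)_k times
(cq^k)_s (q^(k+1))_s / ((q)_s (c)_s) c^s; with the shifted symbols merged, both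
one-step ratios are short and no 1 - cq^(k-1) has to be divided out. *)
Definition weight (k s : nat) : K :=
  qpoch c q (k + s) * qpoch q q (k + s)
  / (qpoch q q k ^+ 2 * qpoch q q s * qpoch c q s)
  * c ^+ s * q ^+ (k + s ^ 2) / q ^+ (s * k.+1).

(** The weight of the even coefficients as a difference in s; its product form
is [even_weightS].  At k = 0 it telescopes to the indicator of s = 0, a case
that the product form does not cover. *)
Definition even_weight (k s : nat) : K :=
  weight k s - if s is t.+1 then c * q ^+ (2 * t) * weight k t else 0.

(** The common shape of the n-dependent factors: m = n serves the even
coefficients and m = n + 1 the odd ones. *)
Definition node (n m s k : nat) : K :=
  qpoch (q ^+ s / q ^+ n) q k * qpoch (c * q ^+ (m + s)) q k.

Definition sign_power (n : nat) : K := (-1) ^+ n * q ^+ 'C(n, 2).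

(** The range s < n + 1 - k is empty for k > n, so this array and [odd_coef]
vanish there, as coefficients beyond the degree should. *)
Definition even_coef (n k : nat) : K :=
  sign_power n / qpoch c q (2 * n)
  * \sum_(s < n.+1 - k) even_weight k s * node n n s k.

Definition odd_coef (n k : nat) : K :=
  sign_power n / qpoch c q (2 * n).+1
  * \sum_(s < n.+1 - k)
      weight k s * (1 - c * q ^+ (k + 2 * s)) * node n n.+1 s k.

Lemma qX_neq0 i : q ^+ i != 0.
Proof. exact: expf_neq0. Qed.

Lemma qpoch_q_neq0 n : qpoch q q n != 0.
Proof. by apply: qpoch_neq0 => i _; rewrite -exprS. Qed.

Lemma qpoch_qV_neq0 n s : (s <= n)%N -> qpoch (q ^+ n)^-1 q s != 0.
Proof.
move=> le_sn; apply: qpoch_neq0 => i lt_is.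
have -> : n = (i + (n - i.+1).+1)%N by lia.
rewrite exprD invfM mulrAC mulVf ?qX_neq0 // mul1r.
have x_neq0 := qX_neq0 (n - i.+1).+1; have := q_gen (n - i.+1).
move: (q ^+ _) x_neq0 => x x_neq0 x_neq1.
have -> : 1 - x^-1 = - (1 - x) / x by field.
by rewrite mulf_neq0 ?oppr_eq0 ?invr_eq0.
Qed.

Lemma qpoch_c_neq0 n : qpoch c q n != 0.
Proof. exact: qpoch_neq0. Qed.

Lemma lambda_odd n : lommel_lambda c q (2 * n).+1 =
  q ^+ n / ((1 - c * q ^+ (2 * n)) * (1 - c * q ^+ (2 * n).+1)).
Proof.
rewrite /lommel_lambda /= mul2n odd_double /= uphalf_double -mul2n.
have -> : (2 * n%:Z = (2 * n)%N%:Z)%R by lia.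
by have -> : ((2 * n)%N%:Z + 1 = (2 * n).+1%:Z)%R by lia.
Qed.

Lemma lambda_even n : lommel_lambda c q (2 * n).+2 =
  c * q ^+ (3 * n + 2)
  / ((1 - c * q ^+ (2 * n).+1) * (1 - c * q ^+ (2 * n).+2)).
Proof.
rewrite /lommel_lambda /= mul2n odd_double /= doubleK -mul2n.
have -> : (3 * n.+1%:Z - 1 = (3 * n + 2)%N%:Z)%R by lia.
have -> : (2 * n.+1%:Z - 1 = (2 * n).+1%:Z)%R by lia.
by have -> : (2 * n.+1%:Z = (2 * n).+2%:Z)%R by lia.
Qed.

Lemma sign_powerS n : sign_power n.+1 = - sign_power n * q ^+ n.
Proof. by rewrite /sign_power binS bin1 exprD exprS; ring. Qed.

(** * Ratios of weights *)

Lemma weight_succ_index k s : weight k.+1 s =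
  weight k s * ((1 - c * q ^+ (k + s)) * (1 - q ^+ (k + s).+1)
                / (1 - q ^+ k.+1) ^+ 2 * q / q ^+ s).
Proof.
rewrite /weight addSn !qpochSr addSn -!exprS (mulnS s k.+1) (exprD q s).
rewrite (exprS q (k + s ^ 2)).
have := (qpoch_q_neq0 k, qpoch_q_neq0 s, qpoch_c_neq0 s, q_gen k).
have := (qX_neq0 s, qX_neq0 (s * k.+1)).
move: (q ^+ s) (q ^+ (s * k.+1)) (q ^+ k.+1) (qpoch q q k) (qpoch q q s).
move: (qpoch c q s) => x1 x2 x3 x4 x5 x6 [h1 h2] [[[h3 h4] h5] h6].
by field; rewrite h1 h2 h3 h4 h5 h6.
Qed.

Lemma weight_succ_sum k s : weight k s.+1 =
  weight k s * ((1 - c * q ^+ (k + s)) * (1 - q ^+ (k + s).+1)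
                / ((1 - q ^+ s.+1) * (1 - c * q ^+ s))
                * c * q ^+ (2 * s) / q ^+ k).
Proof.
rewrite /weight addnS !qpochSr -!exprS mulSn (exprD q k.+1) (exprS q k).
have -> : (k + s.+1 ^ 2 = (k + s ^ 2) + (2 * s).+1)%N.
  by rewrite -!mulnn; lia.
rewrite (exprD q (k + s ^ 2)) (exprS q (2 * s)) (exprS c).
have := (qpoch_q_neq0 k, qpoch_q_neq0 s, qpoch_c_neq0 s, q_gen s, c_gen s).
have := (qX_neq0 k, qX_neq0 (s * k.+1)).
move: (q ^+ k) (q ^+ (s * k.+1)) (q ^+ s.+1) (qpoch q q k) (qpoch q q s).
move: (qpoch c q s) (q ^+ s) => x1 x2 x3 x4 x5 x6 x7.
move=> [h1 h2] [[[[h3 h4] h5] h6] h7].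
by field; rewrite h1 h2 h3 h4 h5 h6 h7.
Qed.

Lemma even_weight0 s : even_weight 0 s = (s == 0)%:R.
Proof.
case: s => [|s].
  rewrite /even_weight /weight !qpoch0 mul0n addn0.
  by rewrite !expr0 expr1n !mulr1 invr1 !mulr1 subr0.
rewrite /even_weight weight_succ_sum add0n expr0 /=.
by field; rewrite oner_neq0 c_gen q_gen.
Qed.

(** Both terms of the difference are multiples of [weight k], and the sum of
the multipliers factors:
(1 - cq^(k+s)) (1 - q^(k+1+s)) - q^k (1 - q^s) (q - cq^s)
= (1 - q^(k+1)) (1 - cq^(k+2s)). *)
Lemma even_weightS k s : even_weight k.+1 s =
  weight k s * (1 - c * q ^+ (k + 2 * s)) * q / (q ^+ s * (1 - q ^+ k.+1)).
Proof.
rewrite /even_weight; case: s => [|s].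
  rewrite weight_succ_index subr0 muln0 !addn0 expr0.
  by field; rewrite q_gen oner_neq0.
rewrite !weight_succ_index weight_succ_sum addnS.
have -> : (k + 2 * s.+1 = k + 2 * s + 2)%N by lia.
rewrite mul2n -addnn !(exprD, exprS, expr1, expr0).
have := (q_gen k, q_gen s, c_gen s, qX_neq0 k, qX_neq0 s).
rewrite !exprS => -[[[[h1 h2] h3] h4] h5].
by field; rewrite h1 h2 h3 h4 h5 q_neq0.
Qed.

(** * Nodes *)

(** On the line s + k = n + 1 the last factor of (q^(s-n))_k is 1 - q^0, which
makes the terms just outside the summation range vanish unless k = 0. *)
Lemma node_boundary n m s k : (s + k = n.+1)%N -> node n m s k = (k == 0)%:R.
Proof.
case: k => [|k] skE; first by rewrite /node !qpoch0 mulr1.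
rewrite /node (@qpoch_eq0 _ _ _ _ k) ?mul0r //.
have -> : n = (s + k)%N by lia.
by rewrite mulrAC -exprD divff // qX_neq0.
Qed.

(** The two nodes share all factors but one of each Pochhammer symbol, and
(1 - q^(s+k-n)) (1 - cq^(n+s)) - (1 - q^(s-n-1)) (1 - cq^(n+s+k+1))
= (1 - q^(k+1)) q^(s-n-1) (1 - cq^(2n+1)). *)
Lemma node_diff_odd n s k :
  node n n s k.+1 - node n.+1 n.+1 s k.+1 =
  (1 - q ^+ k.+1) * (1 - c * q ^+ (2 * n).+1) * (q ^+ s / q ^+ n.+1)
  * node n n.+1 s k.
Proof.
rewrite /node (qpochSr (q ^+ s / q ^+ n)) (qpochSl (c * q ^+ (n + s))).
rewrite (qpochSl (q ^+ s / q ^+ n.+1)) (qpochSr (c * q ^+ (n.+1 + s))).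
have -> : q ^+ s / q ^+ n.+1 * q = q ^+ s / q ^+ n.
  by rewrite exprS; field; rewrite q_neq0 qX_neq0.
have -> : c * q ^+ (n + s) * q = c * q ^+ (n.+1 + s).
  by rewrite addSn exprS; ring.
move: (qpoch _ q k) (qpoch _ q k) => x y.
rewrite mul2n -addnn !(exprD, exprS).
by field; rewrite q_neq0 qX_neq0.
Qed.

(** For k > 0 the four nodes share all factors but one of each Pochhammer
symbol.  Once these and the factor 1 - cq^(2n+2) are removed, both sides become
(1 - cq^(k+2s)) (1 + cq^(k+2s) - q^s y), where y = q^-(n+1) + cq^(n+1). *)
Lemma node_diff_even n s k :
  (1 - c * q ^+ (k + 2 * s))
  * (node n.+1 n.+2 s k - c * q ^+ (2 * n).+2 * node n n.+1 s k) =
  (1 - c * q ^+ (2 * n).+2)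
  * (node n.+1 n.+1 s k - c * q ^+ (2 * s) * node n.+1 n.+1 s.+1 k).
Proof.
rewrite /node; case: k => [|k]; first by rewrite !qpoch0 add0n; ring.
have eqSS : q ^+ s.+1 / q ^+ n.+1 = q ^+ s / q ^+ n.
  by rewrite !exprS; field; rewrite q_neq0 qX_neq0.
rewrite eqSS !addnS !addSn.
rewrite (qpochSr (q ^+ s / q ^+ n)) (qpochSl (q ^+ s / q ^+ n.+1)).
rewrite (qpochSl (c * q ^+ (n + s).+1)) (qpochSr (c * q ^+ (n + s).+2)).
have -> : q ^+ s / q ^+ n.+1 * q = q ^+ s / q ^+ n.
  by rewrite exprS; field; rewrite q_neq0 qX_neq0.
have -> : c * q ^+ (n + s).+1 * q = c * q ^+ (n + s).+2.
  by rewrite !exprS; ring.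
move: (qpoch _ q k) (qpoch _ q k) => x y.
rewrite !mul2n -!addnn !(exprD, exprS).
by field; rewrite q_neq0 qX_neq0.
Qed.

(** * The two recurrences for the coefficients *)

(** The last term is kept because it does not vanish at k = 0. *)
Lemma even_weight_parts k (f : nat -> K) M :
  \sum_(s < M.+1) even_weight k s * f s =
  \sum_(s < M.+1) weight k s * (f s - c * q ^+ (2 * s) * f s.+1)
  + c * q ^+ (2 * M) * weight k M * f M.+1.
Proof.
elim: M => [|M IHM].
  by rewrite !big_ord_recr !big_ord0 /even_weight /=; ring.
by rewrite big_ord_recr [in RHS]big_ord_recr IHM /even_weight /=; ring.
Qed.

(** Only s = 0 contributes to the constant coefficient. *)
Lemma even_coef0 n : even_coef n 0 = sign_power n / qpoch c q (2 * n).
Proof.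
rewrite /even_coef subn0 big_ord_recl big1 => [|s _].
  by rewrite even_weight0 /node !qpoch0 !mulr1 addr0 mulr1.
by rewrite even_weight0 mul0r.
Qed.

Lemma even_coefS0 n :
  even_coef n.+1 0 = - (lommel_lambda c q (2 * n).+1 * even_coef n 0).
Proof.
rewrite !even_coef0 lambda_odd sign_powerS mulnS !qpochSr.
have := (c_gen (2 * n), c_gen (2 * n).+1, qpoch_c_neq0 (2 * n)).
by move=> [[h1 h2] h3]; field; rewrite h1 h2 h3.
Qed.

Lemma even_coefSS n k : (k <= n)%N ->
  even_coef n.+1 k.+1 =
  odd_coef n k - lommel_lambda c q (2 * n).+1 * even_coef n k.+1.
Proof.
move=> le_kn; rewrite /even_coef /odd_coef !subSS subSn //.
(* Adding the vanishing term s = n - k gives all three sums one range. *)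
have -> : \sum_(s < n - k) even_weight k.+1 s * node n n s k.+1 =
          \sum_(s < (n - k).+1) even_weight k.+1 s * node n n s k.+1.
  by rewrite big_ord_recr /= node_boundary ?mulr0 ?addr0 //; lia.
have -> : \sum_(s < (n - k).+1) even_weight k.+1 s * node n.+1 n.+1 s k.+1 =
  \sum_(s < (n - k).+1) even_weight k.+1 s * node n n s k.+1
  - (1 - c * q ^+ (2 * n).+1) / q ^+ n
    * \sum_(s < (n - k).+1)
        weight k s * (1 - c * q ^+ (k + 2 * s)) * node n n.+1 s k.
  rewrite mulr_sumr -sumrB; apply: eq_bigr => s _.
  have -> : node n.+1 n.+1 s k.+1 = node n n s k.+1 -
      (1 - q ^+ k.+1) * (1 - c * q ^+ (2 * n).+1) * (q ^+ s / q ^+ n.+1)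
      * node n n.+1 s k.
    by rewrite -node_diff_odd; ring.
  rewrite even_weightS (exprS q n).
  have := (q_gen k, qX_neq0 s, qX_neq0 n) => -[[h1 h2] h3].
  by field; rewrite h1 h2 h3 q_neq0.
rewrite lambda_odd sign_powerS mulnS !qpochSr.
have := (c_gen (2 * n), c_gen (2 * n).+1, qpoch_c_neq0 (2 * n), qX_neq0 n).
by move=> [[[h1 h2] h3] h4]; field; rewrite h1 h2 h3 h4.
Qed.

Lemma odd_coefS n k : (k <= n.+1)%N ->
  odd_coef n.+1 k =
  even_coef n.+1 k - lommel_lambda c q (2 * n).+2 * odd_coef n k.
Proof.
move=> le_kn; rewrite /even_coef /odd_coef subSn //.
set M := (n.+1 - k)%N.
have MkE : (M + k = n.+1)%N by rewrite /M; lia.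
rewrite (even_weight_parts k (fun s => node n.+1 n.+1 s k)).
rewrite (@node_boundary n.+1 n.+1 M.+1 k) ?addSn ?MkE //.
(* The sum for n stops one term short of that for n + 1; the missing term is
   nonzero only at k = 0, where it cancels the boundary term above. *)
have -> : \sum_(s < M)
      weight k s * (1 - c * q ^+ (k + 2 * s)) * node n n.+1 s k =
    \sum_(s < M.+1)
      weight k s * (1 - c * q ^+ (k + 2 * s)) * node n n.+1 s k
    - weight k M * (1 - c * q ^+ (k + 2 * M)) * (k == 0)%:R.
  by rewrite big_ord_recr /= (node_boundary _ MkE); ring.
have c2 := c_gen (2 * n).+2.
have -> : \sum_(s < M.+1) weight k s *
      (node n.+1 n.+1 s k - c * q ^+ (2 * s) * node n.+1 n.+1 s.+1 k) =
    (\sum_(s < M.+1)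
       weight k s * (1 - c * q ^+ (k + 2 * s)) * node n.+1 n.+2 s k
     - c * q ^+ (2 * n).+2 * \sum_(s < M.+1)
       weight k s * (1 - c * q ^+ (k + 2 * s)) * node n n.+1 s k)
    / (1 - c * q ^+ (2 * n).+2).
  rewrite mulr_sumr -sumrB mulr_suml; apply: eq_bigr => s _.
  apply: (mulIf c2); rewrite divfK //.
  rewrite [LHS]mulrAC -[LHS]mulrA.
  by rewrite -node_diff_even; ring.
rewrite lambda_even sign_powerS mulnS !add2n !qpochSr.
have expE : c * q ^+ (3 * n + 2) = c * q ^+ (2 * n).+2 * q ^+ n.
  by rewrite -mulrA -exprD; congr (c * q ^+ _); lia.
rewrite expE.
have := (c_gen (2 * n), c_gen (2 * n).+1, qpoch_c_neq0 (2 * n), c2).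
(* At k = 0 the boundary terms survive, with M = n + 1. *)
case: k le_kn @M MkE => [|k] le_kn M MkE [[[h1 h2] h3] h4] /=; last first.
  by field; rewrite h1 h2 h3 h4.
have -> : (0 + 2 * M = (2 * n).+2)%N by lia.
have -> : (2 * M = (2 * n).+2)%N by lia.
by field; rewrite h1 h2 h3 h4.
Qed.

(** * The polynomials *)

Definition even_lommel (n : nat) : {poly K} :=
  \sum_(k < n.+1) even_coef n k *: 'X^(2 * k).

Definition odd_lommel (n : nat) : {poly K} :=
  \sum_(k < n.+1) odd_coef n k *: 'X^((2 * k).+1).

Lemma even_lommelS n :
  even_lommel n.+1 =
  'X * odd_lommel n - lommel_lambda c q (2 * n).+1 *: even_lommel n.
Proof.
have -> : even_lommel n = \sum_(k < n.+2) even_coef n k *: 'X^(2 * k).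
  rewrite [RHS]big_ord_recr /= /even_coef subnn big_ord0 mulr0 scale0r.
  by rewrite addr0.
rewrite /even_lommel big_ord_recl [in RHS]big_ord_recl even_coefS0 /=.
rewrite scalerDr opprD addrCA scalerA scaleNr; congr (_ + _).
rewrite /odd_lommel mulr_sumr scaler_sumr -sumrB; apply: eq_bigr => k _.
rewrite /bump /= add1n even_coefSS; last by rewrite -ltnS.
by rewrite scalerBl scalerA -scalerAr -exprS mulnS.
Qed.

Lemma odd_lommelS n :
  odd_lommel n.+1 =
  'X * even_lommel n.+1 - lommel_lambda c q (2 * n).+2 *: odd_lommel n.
Proof.
have -> : odd_lommel n = \sum_(k < n.+2) odd_coef n k *: 'X^((2 * k).+1).
  rewrite [RHS]big_ord_recr /= /odd_coef subnn big_ord0 mulr0 scale0r.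
  by rewrite addr0.
rewrite mulr_sumr scaler_sumr -sumrB; apply: eq_bigr => k _.
rewrite odd_coefS; last by rewrite -ltnS.
by rewrite scalerBl scalerA -scalerAr -exprS.
Qed.

Lemma even_coef00 : even_coef 0 0 = 1.
Proof.
by rewrite even_coef0 /sign_power muln0 bin0n qpoch0 !expr0 !mulr1 divr1.
Qed.

Lemma odd_coef00 : odd_coef 0 0 = 1.
Proof.
rewrite /odd_coef big_ord1 /weight /node /sign_power bin0n !qpochSr !qpoch0.
rewrite !expr0 /=.
by have := c_gen 0; rewrite expr0 mulr1 => h; field; rewrite h oner_neq0.
Qed.

Lemma lommel_pairE n :
  lommel_pair c q (2 * n).+1 = (even_lommel n, odd_lommel n).
Proof.
elim: n => [|n IHn].
  rewrite /even_lommel /odd_lommel !big_ord_recr !big_ord0 /= !add0r.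
  by rewrite even_coef00 odd_coef00 !scale1r scaler0 subr0 mulr1.
rewrite mulnS !addSn add0n.
have -> : lommel_pair c q (2 * n).+3 =
  let: (p, r) := lommel_pair c q (2 * n).+1 in
  let r' := 'X * r - lommel_lambda c q (2 * n).+1 *: p in
  (r', 'X * r' - lommel_lambda c q (2 * n).+2 *: r).
  by rewrite -[(2 * n).+3]/((2 * n).+1.+2) /=; case: (lommel_pair c q (2 * n)).
by rewrite IHn /= -even_lommelS -odd_lommelS.
Qed.

Lemma lommel_even n : lommel c q (2 * n) = even_lommel n.
Proof.
have -> : lommel c q (2 * n) = (lommel_pair c q (2 * n).+1).1.
  by rewrite /lommel /=; case: (lommel_pair c q (2 * n)).
by rewrite lommel_pairE.
Qed.

(** * The very-well-poised form of the coefficients *)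

(** At k = 0 = s the summand contains (1 - c/q) / (1 - c/q). *)
Hypothesis c_neq_q : c != q.

(** Where n collapses into the node: [qpoch_exchange] is applied to both
q^-n and cq^n. *)
Lemma even_summandE n k s : (k + s <= n)%N ->
  (qpochs [:: q ^ (- n%:Z); c * q ^+ n; c] q k / qpoch q q k * q ^+ k) *
  (qpoch (c * q ^ (k%:Z - 1)) q s / qpoch q q s *
     ((1 - c * q ^ (k%:Z - 1 + 2 * s%:Z)) / (1 - c * q ^ (k%:Z - 1))) *
     (qpochs [:: c * q ^+ (n + k); q ^ (k%:Z - n%:Z); q ^+ k] q s /
      qpochs [:: q ^ (- n%:Z); c * q ^+ n; c] q s) *
     c ^+ s * q ^ (- (s%:Z * k%:Z) + s%:Z * (s%:Z - 1)))
  = even_weight k s * node n n s k.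
Proof.
move=> le_ksn; rewrite /qpochs !big_cons !big_nil !mulr1.
have exprVz i : q ^ (- i%:Z) = (q ^+ i)^-1 by rewrite exprnN.
case: k le_ksn => [|k] le_ksn.
  (* The factor (q^k)_s = (1)_s leaves only s = 0. *)
  rewrite even_weight0; case: s le_ksn => [|s] _; last first.
    by rewrite (qpochSl (q ^+ 0)) expr0 subrr !(mul0r, mulr0).
  rewrite /node !qpoch0 mulr0 addr0 mul0r oppr0 addr0 sub0r !expr0 expr0z.
  have cq : 1 - c / q != 0.
    by rewrite subr_eq0 eq_sym -(inj_eq (mulIf q_neq0)) divfK // mul1r.
  by rewrite (exprVz 1%N) expr1 (divff cq) !(mul1r, mulr1, invr1).
rewrite even_weightS.
have -> : k.+1%:Z - 1 = k%:Z by lia.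
have -> : k%:Z + 2 * s%:Z = (k + 2 * s)%N%:Z by lia.
have -> : - (s%:Z * k.+1%:Z) + s%:Z * (s%:Z - 1)
          = (s ^ 2)%N%:Z - (s * k.+2)%N%:Z by rewrite -mulnn; nia.
rewrite !expfzDr // !exprVz -!exprnP (mulrC (q ^+ k.+1)) (exprD q n) (mulrA c).
have swap_q := qpoch_exchange (q ^+ n)^-1 q k.+1 s.
have swap_c := qpoch_exchange (c * q ^+ n) q k.+1 s.
have c_split : qpoch c q (k + s) =
    qpoch c q k.+1 * qpoch (c * q ^+ k) q s / (1 - c * q ^+ k).
  by rewrite qpochSr qpochD; field; rewrite c_gen.
have q_split : qpoch q q (k + s) = qpoch q q k * qpoch (q ^+ k.+1) q s.
  by rewrite qpochD -exprS.
rewrite /weight /node c_split q_split (qpochSr q q k) -exprS.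
rewrite (exprD q n s) (mulrA c) [q ^+ s / _]mulrC.
have n1 := qpoch_qV_neq0 (leq_trans (leq_addl _ _) le_ksn).
have n2 : qpoch (c * q ^+ n) q s != 0.
  by apply: qpoch_neq0 => i _; rewrite -mulrA -exprD.
have -> : qpoch ((q ^+ n)^-1 * q ^+ s) q k.+1 =
    qpoch (q ^+ n)^-1 q k.+1 * qpoch ((q ^+ n)^-1 * q ^+ k.+1) q s
    / qpoch (q ^+ n)^-1 q s
  by apply: (canRL (mulfK n1)); rewrite [LHS]mulrC -swap_q.
have -> : qpoch (c * q ^+ n * q ^+ s) q k.+1 =
    qpoch (c * q ^+ n) q k.+1 * qpoch (c * q ^+ n * q ^+ k.+1) q s
    / qpoch (c * q ^+ n) q s
  by apply: (canRL (mulfK n2)); rewrite [LHS]mulrC -swap_c.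
have -> : q ^+ (s * k.+2) = q ^+ s * q ^+ (s * k.+1) by rewrite -exprD mulnS.
rewrite (exprD q k) (exprS q k).
have := (qpoch_q_neq0 k, qpoch_q_neq0 s, qpoch_c_neq0 s, q_gen k, c_gen k).
have := (qX_neq0 s, qX_neq0 (s * k.+1)).
rewrite exprS => -[h1 h2] [[[[h3 h4] h5] h6] h7].
by field; rewrite n1 n2 h1 h2 h3 h4 h5 h6 h7.
Qed.

Lemma lommel_even_formula n :
  lommel c q (2 * n) =
  ((-1) ^+ n * q ^+ 'C(n, 2) / qpoch c q (2 * n)) *:
  \sum_(k < n.+1)
    (qpochs [:: q ^ (- n%:Z); c * q ^+ n; c] q k / qpoch q q k * q ^+ k *
     \sum_(s < (n - k).+1)
       (qpoch (c * q ^ (k%:Z - 1)) q s / qpoch q q s *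
        ((1 - c * q ^ (k%:Z - 1 + 2 * s%:Z)) / (1 - c * q ^ (k%:Z - 1))) *
        (qpochs [:: c * q ^+ (n + k); q ^ (k%:Z - n%:Z); q ^+ k] q s /
         qpochs [:: q ^ (- n%:Z); c * q ^+ n; c] q s) *
        c ^+ s * q ^ (- (s%:Z * k%:Z) + s%:Z * (s%:Z - 1))))
    *: 'X^(2 * k).
Proof.
rewrite lommel_even /even_lommel scaler_sumr; apply: eq_bigr => k _.
have le_kn : (k <= n)%N by rewrite -ltnS.
rewrite scalerA /even_coef subSn //; congr (_ * _ *: _).
rewrite mulr_sumr; apply: eq_bigr => s _; rewrite even_summandE //.
by have := ltn_ord s; lia.
Qed.

End EvenOddCoefficients.

(** * Two indeterminates *)

Section Indeterminates.

Variable F : fieldType.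

Lemma indet_monomial_neq1 i j : (0 < i + j)%N ->
  1 - indet_c F ^+ i * indet_q F ^+ j != 0.
Proof.
move=> ij_gt0; rewrite /indet_c /indet_q -!tofracXn -tofracM -tofrac1 -tofracB.
rewrite tofrac_eq0 !mpolyXn -mpolyXD subr_eq0; apply/eqP.
move/(congr1 (fun p => p@_(0%MM))); rewrite mcoeff1 mcoeffX eqxx.
case: eqP => [/mnmP e|_ /eqP]; last by rewrite oner_eq0.
have := e 0; have := e 1.
by rewrite !mnmDE !mulmnE !mnm1E !mnm0E /=; lia.
Qed.

Lemma indet_q_neq0 : indet_q F != 0.
Proof.
rewrite /indet_q tofrac_eq0; apply/eqP => /(congr1 (fun p => p@_U_(1))).
by rewrite mcoeffXU mcoeff0 eqxx => /eqP; rewrite oner_eq0.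
Qed.

Lemma indet_c_neq_q : indet_c F != indet_q F.
Proof.
rewrite /indet_c /indet_q tofrac_eq; apply/eqP.
move=> /(congr1 (fun p => p@_U_(1))).
by rewrite !mcoeffXU eqxx => /eqP; rewrite eq_sym oner_eq0.
Qed.

End Indeterminates.

Theorem theorem4p1 (F : fieldType) (n : nat) :
  let c := indet_c F in
  let q := indet_q F in
  lommel c q (2 * n) =
  ((-1) ^+ n * q ^+ 'C(n, 2) / qpoch c q (2 * n)) *:
  \sum_(k < n.+1)
    (qpochs [:: q ^ (- n%:Z); c * q ^+ n; c] q k / qpoch q q k * q ^+ k *
     \sum_(s < (n - k).+1)
       (qpoch (c * q ^ (k%:Z - 1)) q s / qpoch q q s *
        ((1 - c * q ^ (k%:Z - 1 + 2 * s%:Z)) / (1 - c * q ^ (k%:Z - 1))) *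
        (qpochs [:: c * q ^+ (n + k); q ^ (k%:Z - n%:Z); q ^+ k] q s /
         qpochs [:: q ^ (- n%:Z); c * q ^+ n; c] q s) *
        c ^+ s * q ^ (- (s%:Z * k%:Z) + s%:Z * (s%:Z - 1))))
    *: 'X^(2 * k).
Proof.
apply: lommel_even_formula => [|i|i|].
- exact: indet_q_neq0.
- by have := @indet_monomial_neq1 F 0 i.+1 isT; rewrite expr0 mul1r.
- by have := @indet_monomial_neq1 F 1 i isT; rewrite expr1.
- exact: indet_c_neq_q.
Qed.
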